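(* For every integer $k\geq 1$ and every $1\leq p\leq\infty$ there exists a constant $C_{k,p}>0$, depending only on $k$ and $p$, such that for every finite subset $A\subset\mathbb{Z}$ with characteristic function $\chi_A$, $$\|\chi_A^{(k)}\|_{l^p(\mathbb{Z})}\geq C_{k,p}\,\|\chi_A'\|_{l^p(\mathbb{Z})}.$$
   Context: For $f:\mathbb{Z}\to\mathbb{R}$ and an integer $k\geq 1$, the discrete derivative (forward difference) of order $k$ is $f^{(k)}(n):=\sum_{j=0}^{k}\binom{k}{j}(-1)^{j}f(n+k-j)$, $n\in\mathbb{Z}$; $f'=f^{(1)}$, so $f'(n)=f(n+1)-f(n)$. *)

(* Defs.v *)
From HB Require Import structures.
From mathcomp Require Import all_boot all_order all_algebra.
From mathcomp Require Import all_classical all_reals all_analysis.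

Set Implicit Arguments.
Unset Strict Implicit.
Unset Printing Implicit Defensive.

Import Order.TTheory GRing.Theory Num.Theory.

Local Open Scope classical_set_scope.
Local Open Scope ring_scope.

(* MathComp-Analysis equips nat with its discrete sigma-algebra, but not int;
   measurable types are required to be pointed. *)
HB.instance Definition _ := isPointed.Build int 0.
HB.instance Definition _ := @isMeasurable.Build default_measure_display
  int discrete_measurable discrete_measurable0
  discrete_measurableC discrete_measurableU.

(* The terms k%:Z and j%:Z are subtracted in int: nat subtraction truncates. *)
Definition fdiff (R : realType) (k : nat) (f : int -> R) (n : int) : R :=
  \sum_(0 <= j < k.+1) 'C(k, j)%:R * (-1) ^+ j * f (n + k%:Z - j%:Z).

Lemma fdiff1 (R : realType) (f : int -> R) (n : int) :
  fdiff 1 f n = f (n + 1) - f n.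
Proof.
rewrite /fdiff big_nat_recr//= big_nat1 expr0 expr1 bin0 bin1.
by rewrite subr0 addrK !mul1r mulN1r.
Qed.

(* l^p(Z) is L^p for the counting measure on the discrete space int; its only
   null set is empty, so that for p = +oo the essential supremum is the supremum
   of |f|. The value is +oo when f is not in l^p(Z). *)
Definition lpnorm (R : realType) (p : \bar R) (f : int -> R) : \bar R :=
  ('N[@counting int R]_p [EFin \o f])%E.

(* Main.v *)
From HB Require Import structures.
Require Import Defs.
From mathcomp Require Import finmap all_boot all_order all_algebra.
From mathcomp Require Import all_classical all_reals all_analysis.
From mathcomp Require Import ess_sup_inf zify.

(** Write f for the indicator of A and f^(k) for its k-th difference.  All the
differences of f are integer-valued, so f^(k) has absolute value at least 1
wherever it does not vanish, while f' has absolute value at most 1.  Hence a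
pointwise bound

  |f' n| <= \sum_(i <= L) |f^(k) (n + i)|,   with L depending on k only,

follows as soon as f' n = 0 whenever f^(k) vanishes on the window n, ..., n + L
(fdiff1_indic_le).  This implication holds for every bounded integer-valued
function (fdiff1_window): by induction on k, applied to f' instead of f, the
vanishing of f^(k) on a long window makes f'' vanish on a long window, so f' is
constant there; were this constant nonzero, it would be at least 1 in absolute
value and f would drift by more than its bound allows.

Taking l^p norms, the pointwise bound, Minkowski's inequality and the
translation invariance of the norm give ||f'||_p <= (L + 1) ||f^(k)||_p, so
that 1 / (L + 1) is a suitable constant for all p at once. *)

Set Implicit Arguments.
Unset Strict Implicit.
Unset Printing Implicit Defensive.

Import Order.TTheory GRing.Theory Num.Theory.

Local Open Scope classical_set_scope.
Local Open Scope ring_scope.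

(** * Finite differences of integer-valued functions *)

Lemma fdiffS (R : realType) k (f : int -> R) n :
  fdiff k.+1 f n = fdiff k (fdiff 1 f) n.
Proof.
rewrite /fdiff big_nat_recl//= bin0 expr0.
have fd1 j : fdiff 1 f (n + k%:Z - j%:Z) =
    f (n + k.+1%:Z - j%:Z) - f (n + k.+1%:Z - j.+1%:Z).
  by rewrite fdiff1; congr (f _ - f _); lia.
under [RHS]eq_bigr do rewrite -/(fdiff 1 f _) fd1 mulrBr.
rewrite sumrB [X in _ = X - _]big_nat_recl// bin0 expr0 -[RHS]addrA; congr (_ + _).
under [LHS]eq_bigr do rewrite binS natrD 2!mulrDl.
rewrite big_split/=; congr (_ + _).
  by rewrite big_nat_recr//= bin_small// 2!mul0r addr0.
rewrite -sumrN; apply: eq_bigr => j _.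
by rewrite exprS mulN1r mulrN mulNr.
Qed.

Lemma fdiff_int (R : realType) k (f : int -> R) n :
  (forall x, f x \is a Num.int) -> fdiff k f n \is a Num.int.
Proof.
move=> fint; rewrite /fdiff rpred_sum// => j _.
by rewrite !rpredM// ?rpredX ?rpredN ?rpred1 ?rpred_nat.
Qed.

Lemma fdiff1_le (R : realType) (M : R) (f : int -> R) n :
  (forall x, `|f x| <= M) -> `|fdiff 1 f n| <= M *+ 2.
Proof.
by move=> fM; rewrite fdiff1 mulr2n (le_trans (ler_normB _ _))// lerD.
Qed.

(** A bounded integer-valued function cannot have a constant nonzero slope on a
window longer than twice its bound.  The bound M is a parameter because the
induction on k passes from f to its first difference, whose bound is doubled; a
window of length L + 2 * M for f contains one of length L, as needed for the
first difference, at each of its 2 * M + 1 leftmost points. *)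
Lemma fdiff1_window (R : realType) k M : exists L : nat,
  forall f : int -> R, (forall x, f x \is a Num.int) ->
    (forall x, `|f x| <= M%:R) ->
  forall n : int, (forall i : nat, (i <= L)%N -> fdiff k.+1 f (n + i%:Z) = 0) ->
  fdiff 1 f n = 0.
Proof.
elim: k M => [|k IHk] M.
  by exists 0%N => f _ _ n /(_ 0%N isT); rewrite addr0.
have [L HL] := IHk (M * 2)%N.
exists (L + M * 2)%N => f fint fM n f0.
have f1int x : fdiff 1 f x \is a Num.int by exact: fdiff_int.
have d2 (i : nat) : (i <= M * 2)%N -> fdiff 1 (fdiff 1 f) (n + i%:Z) = 0.
  move=> iM; apply: HL => //.
    by move=> x; rewrite natrM mulr_natr; exact: fdiff1_le.
  by move=> j jL; rewrite -fdiffS -addrA -PoszD f0//; lia.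
have cst (i : nat) : (i <= M * 2)%N -> fdiff 1 f (n + i%:Z) = fdiff 1 f n.
  elim: i => [|i IHi] iM; first by rewrite addr0.
  rewrite -IHi; last by lia.
  have := d2 i (ltnW iM); rewrite fdiff1 => /eqP; rewrite subr_eq0 => /eqP <-.
  by congr fdiff; lia.
have lin : f (n + (M * 2).+1%:Z) - f n = fdiff 1 f n *+ (M * 2).+1.
  have /= := telescope_sumr (fun i => f (n + i%:Z)) (leq0n (M * 2).+1).
  rewrite addr0 => <-.
  rewrite -[(M * 2).+1 in RHS]subn0 -sumr_const_nat.
  apply: eq_big_nat => i /andP[_ iM]; rewrite -(cst i)// fdiff1.
  by congr (f _ - f _); lia.
apply/eqP; apply: contraT => /(norm_intr_ge1 (f1int n)) ge1.
have : `|f (n + (M * 2).+1%:Z) - f n| <= (M * 2)%:R.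
  by rewrite natrM mulr_natr mulr2n (le_trans (ler_normB _ _))// lerD.
by rewrite lin normrMn leNgt (lt_le_trans _ (ler_wMn2r _ ge1))// ltr_nat.
Qed.

(** Both sides are integers and the left one is at most 1, so the inequality says
no more than that the left side vanishes when all the terms on the right do. *)
Lemma fdiff1_indic_le (R : realType) k : exists L : nat,
  forall (A : set int) (n : int),
  `|fdiff 1 (\1_A : int -> R) n|
    <= \sum_(i < L.+1) `|fdiff k.+1 (\1_A : int -> R) (n + i%:Z)|.
Proof.
have [L HL] := fdiff1_window R k 1; exists L => A n.
have f01 x : (\1_A x : R) = 0 \/ (\1_A x : R) = 1.
  by rewrite indicE; case: (_ \in _); [right|left].
have fint x : (\1_A x : R) \is a Num.int.
  by rewrite indicE; exact: rpred_nat.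
have [/existsP[i fi]|/existsPn nex] := boolP [exists i : 'I_L.+1,
    fdiff k.+1 (\1_A : int -> R) (n + i%:Z) != 0].
  rewrite (bigD1 i)//= ler_wpDr ?sumr_ge0//.
  rewrite (le_trans _ (norm_intr_ge1 _ fi)) ?fdiff_int//.
  rewrite fdiff1; case: (f01 (n + 1)) => ->; case: (f01 n) => ->;
  by rewrite ?subrr ?subr0 ?sub0r ?normrN ?normr0 ?normr1.
rewrite HL ?normr0 ?sumr_ge0//.
  by move=> x; case: (f01 x) => ->; rewrite ?normr0 ?normr1.
move=> i iL; apply/eqP.
by have := nex (Ordinal (iL : (i < L.+1)%N)); rewrite negbK.
Qed.

(** * Norms on l^p *)

Lemma counting_preimage_add (R : realType) (a : int) (A : set int) :
  counting ((fun x => x + a) @^-1` A) = counting A :> \bar R.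
Proof.
have -> : (fun x => x + a) @^-1` A = (fun x => x - a) @` A.
  apply/seteqP; split => [x Ax|_ [x Ax <-]]/=; last by rewrite subrK.
  by exists (x + a) => //; rewrite addrK.
have inj : injective (fun x : int => x - a) by exact: addIr.
have [finA|infA] := pselect (finite_set A); last first.
  rewrite /counting !asboolF// => /(finite_image (fun x => x + a)) fin.
  apply: infA; apply: sub_finite_set fin => x Ax /=.
  by exists (x - a); [exists x|rewrite subrK].
rewrite /counting !asboolT//; last exact: finite_image.
by rewrite fset_set_image// card_imfset.
Qed.

Lemma integral_counting_add (R : realType) (a : int) (f : int -> \bar R) :
  (forall x, 0 <= f x)%E ->
  (\int[@counting int R]_x f (x + a)%R =
    \int[@counting int R]_x f x)%E.
Proof.
move=> f0; pose shift x : int := x + a.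
have mshift : measurable_fun setT shift by [].
pose sh : {mfun int >-> int} :=
  HB.pack shift (isMeasurableFun.Build _ _ _ _ _ mshift).
rewrite -(ge0_integral_pushforward mshift counting measurableT)//.
apply: (@eq_measure_integral _ _ _ setT counting (pushforward counting sh)).
by move=> A _ _; exact: counting_preimage_add.
Qed.

(** The finite exponents rest on the translation invariance of the integral; the
infinite ones on that of the measure, once the essential supremum is expressed
through the measures of the sets where the function exceeds a level. *)
Lemma lpnorm_add (R : realType) p (a : int) (f : int -> R) :
  lpnorm p (fun x => f (x + a)) = lpnorm p f.
Proof.
rewrite /lpnorm unlock; case: p => [r| |].
- rewrite (integral_counting_add a (f := fun x => (`|(f x)%:E| `^ r)%E))// => x.
  exact: poweR_ge0.
- case: ifPn => // _; rewrite !ess_supEmu0//; congr ereal_inf.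
  by apply/funext => y; congr (_ = _); exact: (counting_preimage_add R a).
- case: ifPn => // _; rewrite !ess_infEN !ess_supEmu0//; congr (- ereal_inf _)%E.
  by apply/funext => y; congr (_ = _); exact: (counting_preimage_add R a).
Qed.

Lemma le_lpnorm (R : realType) (p : \bar R) (f g : int -> R) : (0 <= p)%E ->
  (forall x, `|f x| <= `|g x|) -> (lpnorm p f <= lpnorm p g)%E.
Proof.
rewrite /lpnorm unlock; case: p => [r|_ fg|//].
  rewrite lee_fin => r0 fg; have ri0 : 0 <= r^-1 by rewrite invr_ge0.
  apply: (gt0_ler_poweR ri0); rewrite ?in_itv/= ?leey ?andbT ?integral_ge0//.
  by apply: ge0_le_integral => // x _; rewrite lee_fin ge0_ler_powR// nnegrE.
case: ifPn => // _; apply: le_ess_sup; apply: nearW => x /=.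
by rewrite lee_fin.
Qed.

Lemma lpnorm_sum_le (R : realType) (p : \bar R) L (F : nat -> int -> R) :
  (1 <= p)%E ->
  (lpnorm p (fun x => (\sum_(i < L) F i x)%R)
     <= \sum_(i < L) lpnorm p (F i))%E.
Proof.
move=> p1; elim: L => [|L IHL].
  have -> : (fun x => \sum_(i < 0) F i x) = cst 0.
    by apply/funext => x; rewrite big_ord0.
  by rewrite big_ord0 /lpnorm Lnorm0// gt_eqF// (lt_le_trans _ p1).
rewrite big_ord_recr/=; apply: (le_trans _ (leeD2r _ IHL)).
rewrite (_ : (fun x => _) = (fun x => \sum_(i < L) F i x) \+ F L); last first.
  by apply/funext => x; rewrite big_ord_recr.
exact: eminkowski.
Qed.

Theorem theorem1 (R : realType) (k : nat) (p : \bar R) :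
  (1 <= k)%N -> (1 <= p)%E ->
  exists C : R, 0 < C /\
    forall A : set int, finite_set A ->
      (C%:E * lpnorm p (fdiff 1 (\1_A : int -> R))
         <= lpnorm p (fdiff k (\1_A : int -> R)))%E.
Proof.
case: k => // k _ p1; have p0 : (0 <= p)%E by exact: le_trans p1.
have [L HL] := fdiff1_indic_le R k.
exists L.+1%:R^-1; split=> [|A _]; first by rewrite invr_gt0.
rewrite lee_pdivrMl//.
pose F (i : nat) (x : int) := `|fdiff k.+1 (\1_A : int -> R) (x + i%:Z)|.
apply: (@le_trans _ _ (lpnorm p (fun x => \sum_(i < L.+1) F i x))).
  by apply: le_lpnorm => // x; rewrite (le_trans (HL A x))// ler_norm.
apply: (le_trans (lpnorm_sum_le _ _ p1)).
have FE i : lpnorm p (F i) = lpnorm p (fdiff k.+1 (\1_A : int -> R)).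
  rewrite -(lpnorm_add p i%:Z (fdiff _ _)) /lpnorm -[RHS]Lnorm_abse.
  exact: eq_Lnorm.
under eq_bigr do rewrite FE.
by rewrite sumr_const card_ord mule_natl.
Qed.
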